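(* (a) There are uncountably many $\alpha>0$ for each of which there exists a triangle in $I^2$ with no edge of slope $\alpha$ that is not a bounded remainder set for the continuous irrational rotation with slope $\alpha$ and arbitrary starting point $\mathbf{x}\in I^2$. (b) There are uncountably many $\alpha>0$ for each of which there exists a disc in $I^2$ that is not a bounded remainder set for the continuous irrational rotation with slope $\alpha$ and arbitrary starting point $\mathbf{x}\in I^2$. (c) The triangle with vertices $(0,0)$, $(1,0)$ and $(0,1)$ is a bounded remainder set for the continuous irrational rotation with slope $\alpha$ and starting point $\mathbf{x}$, for every irrational $\alpha>0$ and every $\mathbf{x}\in I^2$.
   Context: $I=[0,1)$, $I^2=[0,1)^2$, $\{y\}$ denotes the fractional part of $y\in\mathbb{R}$ and $\lambda$ is Lebesgue measure. For irrational $\alpha>0$ and $\mathbf{x}=(x_1,x_2)\in I^2$, the continuous irrational rotation with slope $\alpha$ and starting point $\mathbf{x}$ is $t\mapsto(\{x_1+t\},\{x_2+\alpha t\})$, $t\ge 0$. A measurable set $S\subset I^2$ is a bounded remainder set for this rotation if $\Delta_T(S,\alpha,\mathbf{x})=\int_0^T\chi_S(\{x_1+t\},\{x_2+\alpha t\})\,dt-T\lambda(S)$ is bounded uniformly in $T>0$, where $\chi_S$ is the characteristic function of $S$. *)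

(* Defs.v *)
From HB Require Import structures.
From mathcomp Require Export all_boot all_order all_algebra.
From mathcomp Require Export all_classical all_reals all_analysis.
From mathcomp Require Import measurable_realfun ring.
Set Implicit Arguments.
Unset Strict Implicit.
Unset Printing Implicit Defensive.
Export Order.TTheory GRing.Theory Num.Theory.
Export numFieldNormedType.Exports.
Global Open Scope classical_set_scope.
Global Open Scope ring_scope.

Definition unit_square (R : realType) : set (R * R) := `[0, 1[ `*` `[0, 1[.

Definition frac_part (R : realType) (y : R) : R := y - (Num.floor y)%:~R.

Definition rotation (R : realType) (alpha : R) (x : R * R) (t : R) : R * R :=
  (frac_part (x.1 + t), frac_part (x.2 + alpha * t)).

Definition area (R : realType) (S : set (R * R)) : R :=
  fine ((@lebesgue_measure R \x @lebesgue_measure R)%E S).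

Definition discrepancy (R : realType) (S : set (R * R)) (alpha : R)
    (x : R * R) (T : R) : R :=
  (\int[lebesgue_measure]_(t in `[0, T]) \1_S (rotation alpha x t)) - T * area S.

(* The notion is meant for measurable S included in unit_square; these side
   conditions are not part of the predicate, so that its negation asserts
   genuine unboundedness. *)
Definition bounded_remainder_set (R : realType) (S : set (R * R)) (alpha : R)
    (x : R * R) : Prop :=
  exists C : R, forall T : R, 0 < T -> `|discrepancy S alpha x T| <= C.

Definition triangle (R : realType) (a b c : R * R) : set (R * R) :=
  [set p | exists u v w : R, [/\ 0 <= u, 0 <= v, 0 <= w, u + v + w = 1 &
    p = (u * a.1 + v * b.1 + w * c.1, u * a.2 + v * b.2 + w * c.2)]].

Definition collinear (R : realType) (a b c : R * R) : Prop :=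
  (b.1 - a.1) * (c.2 - a.2) = (b.2 - a.2) * (c.1 - a.1).

(* A vertical segment has no slope. *)
Definition has_slope (R : realType) (p q : R * R) (alpha : R) : Prop :=
  p.1 <> q.1 /\ (q.2 - p.2) / (q.1 - p.1) = alpha.

Definition disc (R : realType) (c : R * R) (r : R) : set (R * R) :=
  [set p | (p.1 - c.1) ^+ 2 + (p.2 - c.2) ^+ 2 <= r ^+ 2].

Lemma measurable_unit_square (R : realType) : measurable (@unit_square R).
Proof. exact: measurableX. Qed.

Lemma measurable_disc (R : realType) (c : R * R) (r : R) :
  measurable (disc c r).
Proof.
pose f (p : R * R) : R := (p.1 - c.1) ^+ 2 + (p.2 - c.2) ^+ 2.
have mf : measurable_fun [set: R * R] f.
  apply: measurable_funD; apply: measurable_funX; apply: measurable_funB => //.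
have -> : disc c r = [set: R * R] `&` f @^-1` `]-oo, r ^+ 2].
  by apply/seteqP; split => p /=; rewrite in_itv /= => // -[].
exact: mf.
Qed.

Lemma measurable_triangle (R : realType) (a b c : R * R) :
  ~ collinear a b c -> measurable (triangle a b c).
Proof.
rewrite /collinear => /eqP; rewrite -subr_eq0.
set d := _ - _ => d0.
pose g (q s p : R * R) : R :=
  ((s.1 - q.1) * (p.2 - q.2) - (s.2 - q.2) * (p.1 - q.1)) / d.
have mg q s : measurable_fun [set: R * R] (g q s).
  apply: measurable_funM => //; apply: measurable_funB;
    by apply: measurable_funM => //; apply: measurable_funB.
have -> : triangle a b c =
    ([set: R * R] `&` g b c @^-1` `[0, +oo[) `&`
    ([set: R * R] `&` g c a @^-1` `[0, +oo[) `&`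
    ([set: R * R] `&` g a b @^-1` `[0, +oo[).
  apply/seteqP; split => p /=.
    move=> [u [v [w [u0 v0 w0 uvw ->]]]].
    have ew : u = 1 - v - w by rewrite -uvw; ring.
    rewrite !in_itv /= !andbT.
    have -> : g b c (u * a.1 + v * b.1 + w * c.1,
                     u * a.2 + v * b.2 + w * c.2) = u.
      by apply: (mulIf d0); rewrite /g divfK //= /d ew; ring.
    have -> : g c a (u * a.1 + v * b.1 + w * c.1,
                     u * a.2 + v * b.2 + w * c.2) = v.
      by apply: (mulIf d0); rewrite /g divfK //= /d ew; ring.
    have -> : g a b (u * a.1 + v * b.1 + w * c.1,
                     u * a.2 + v * b.2 + w * c.2) = w.
      by apply: (mulIf d0); rewrite /g divfK //= /d ew; ring.
    by [].
  rewrite !in_itv /= !andbT => -[[[_ u0] [_ v0]] [_ w0]].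
  exists (g b c p), (g c a p), (g a b p); split => //.
    by apply: (mulIf d0); rewrite /g !mulrDl !divfK //= /d; ring.
  rewrite [LHS]surjective_pairing; congr pair; apply: (mulIf d0).
    by rewrite /g /d; field.
  by rewrite /g /d; field.
by apply: measurableI; [apply: measurableI|]; apply: mg.
Qed.

(* Main.v *)
Require Import Defs.
From mathcomp Require Import measurable_realfun ring lra zify.
Set Implicit Arguments.
Unset Strict Implicit.
Unset Printing Implicit Defensive.

(** Cut the flow into unit time steps: for [S] whose intersection with each line
    of slope [alpha] is a segment, the occupation time of [S] over [N] steps is a
    finite sum of chord lengths [g alpha (y + alpha k - i)], continuous in
    [(alpha, y)].  At a rational slope [p/q] the sum over one period, as a function
    of [y], is not constant for the triangle (kinks) nor for the disc (square-root
    singularity at a tangent line), so it differs from [q * area S] for some [y].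
    For slopes close to [p/q] every orbit drifts near that [y] and then stays near
    it for many periods, which makes the discrepancy large.  The slopes with
    unbounded discrepancy therefore contain a dense G_delta, and the Baire theorem
    gives uncountability.  For the unit triangle, the indicator along an orbit is
    [1 - {u} - {v} + {u + v}] with [u], [v] affine in time, and the integral of a
    sawtooth stays within a constant of [T / 2]. *)

(** * Occupation times as sums of chord lengths *)

Lemma Rintegral_sum (R : realType) (I : Type) (s : seq I) (D : set R)
    (f : I -> R -> R) : measurable D ->
  (forall i, (@lebesgue_measure R).-integrable D (EFin \o f i)) ->
  \int[lebesgue_measure]_(t in D) (\sum_(i <- s) f i t) =
  \sum_(i <- s) \int[lebesgue_measure]_(t in D) f i t.
Proof.
move=> mD intf; elim: s => [|i s IH].
  by under eq_Rintegral do rewrite big_nil; rewrite big_nil Rintegral_cst ?mul0r.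
under eq_Rintegral do rewrite big_cons.
rewrite RintegralD ?IH ?big_cons//.
rewrite (_ : _ \o _ = fun t => (\sum_(i <- s) (f i t)%:E)%E); last first.
  by apply/funext => t /=; rewrite sumEFin.
by apply: integrable_sum => // j _; exact: intf.
Qed.

Lemma measurable_frac_part (R : realType) :
  measurable_fun [set: R] (@frac_part R).
Proof.
apply: measurable_funB => //; apply: nondecreasing_measurable => // x y xy.
by rewrite ler_int; exact: le_floor.
Qed.

Lemma measurable_rotation (R : realType) (alpha : R) (x : R * R) :
  measurable_fun [set: R] (rotation alpha x).
Proof.
apply/measurable_fun_pairP; split;
  (apply: (measurableT_comp (@measurable_frac_part R)); apply: measurable_funD => //).
Qed.

Lemma integrable_indic_comp (R : realType) (T : Type) (S : set T) (f : R -> T)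
    (i : interval R) : ((@lebesgue_measure R) [set` i] < +oo)%E ->
  measurable_fun [set: R] (\1_S \o f : R -> R) ->
  (@lebesgue_measure R).-integrable [set` i] (EFin \o (\1_S \o f : R -> R)).
Proof.
move=> fin mf; apply: measurable_bounded_integrable => //.
  exact: measurable_funTS.
exists 1; split => [|M M1 t _ /=]; first exact: num_real.
by rewrite indicE (le_trans _ (ltW M1))//; case: (_ \in _); rewrite ?normr1 ?normr0.
Qed.

Lemma lebesgue_measure_itv_bnd_fin (R : realType) (a b : R) (c d : bool) :
  ((@lebesgue_measure R) [set` Interval (BSide c a) (BSide d b)] < +oo)%E.
Proof.
by rewrite lebesgue_measure_itv /=; case: ifPn => // _; rewrite -EFinB ltry.
Qed.

Lemma integrable_indic_rotation (R : realType) (S : set (R * R)) (alpha : R)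
    (x : R * R) (a b : R) (c d : bool) : measurable S ->
  (@lebesgue_measure R).-integrable [set` Interval (BSide c a) (BSide d b)]
    (EFin \o (fun t => \1_S (rotation alpha x t) : R)).
Proof.
move=> mS; apply: (@integrable_indic_comp R _ S (rotation alpha x)).
  exact: lebesgue_measure_itv_bnd_fin.
exact: (measurableT_comp (measurable_indic mS) (@measurable_rotation R alpha x)).
Qed.

(** The hypothesis confines [w] to [[k, k + 1[] for every nonzero term, and these intervals are
    disjoint, so only the term at the integer part of [w] can survive. *)
Lemma sum_truncn (R : realType) (N : nat) (w : R) (F : nat -> R) :
  0 <= w < N%:R ->
  (forall k, F k != 0 -> 0 <= w - k%:R < 1) ->
  \sum_(k < N) F k = F (Num.truncn w).
Proof.
move=> /andP[w0 wN] HF.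
have /andP[lw wl] := truncn_itv w0.
have tN : (Num.truncn w < N)%N by rewrite -(ltr_nat R) (le_lt_trans lw).
rewrite (bigD1 (Ordinal tN)) //= big1 ?addr0 // => k kN.
apply/eqP; apply: contraT => /HF /andP[k1 k2].
case/eqP: kN; apply: val_inj => /=; apply/esym.
apply: truncn_def; rewrite -natr1; apply/andP; split; lra.
Qed.

Lemma frac_part_truncn (R : realType) (u : R) (m : int) : 0 <= u - m%:~R ->
  frac_part u = u - m%:~R - (Num.truncn (u - m%:~R))%:R.
Proof.
move=> w0; rewrite /frac_part.
have /andP[lw wl] := truncn_itv w0; rewrite -natr1 in wl.
have -> : Num.floor u = m + (Num.truncn (u - m%:~R))%:Z.
  by apply: floor_def; rewrite !rmorphD /= -pmulrn; apply/andP; split; lra.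
by rewrite rmorphD /= -pmulrn; ring.
Qed.

(** Unfolds the torus: as [S] lies in the unit square, only the translate by the integer parts of
    [u] and [v] can be met, so fractional parts give way to translates of [S] along a straight
    line. *)
Lemma indic_frac_sum (R : realType) (S : set (R * R)) (u v : R) (m n : int)
    (M N : nat) : S `<=` @unit_square R ->
  0 <= u - m%:~R < M%:R -> 0 <= v - n%:~R < N%:R ->
  \1_S (frac_part u, frac_part v) =
  \sum_(k < M) \sum_(i < N)
    \1_S (u - m%:~R - k%:R, v - n%:~R - i%:R) :> R.
Proof.
move=> Ssq uM vN.
have nz (p : R * R) : \1_S p != 0 :> R -> 0 <= p.1 < 1 /\ 0 <= p.2 < 1.
  rewrite indicE pnatr_eq0 eqb0 negbK inE => /Ssq [] /=.
  by rewrite !in_itv /=.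
rewrite (@sum_truncn _ _ (u - m%:~R)
  (fun k => \sum_(i < N) \1_S (u - m%:~R - k%:R, v - n%:~R - i%:R))) //.
  rewrite (@sum_truncn _ _ (v - n%:~R) (fun i => \1_S (_, v - n%:~R - i%:R))) //.
    rewrite -!frac_part_truncn //; first by case/andP: vN.
    by case/andP: uM.
  by move=> i /nz [].
move=> k; apply: contraR => kn; rewrite big1 // => i _.
by apply/eqP; apply: contraR kn => /nz [].
Qed.

(** Lengths are measured in time, that is along the first axis. A line that misses [S] has
    [hi < lo], whence the maximum with [0]. *)
Definition chord_length (R : realType) (S : set (R * R)) (g : R -> R -> R) :=
  forall alpha z : R, 0 < alpha -> exists lo hi : R,
    (forall t, S (t, z + alpha * t) <-> lo <= t <= hi) /\
    g alpha z = Num.max 0 (hi - lo).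

(** [y] is the height of the orbit at an integer abscissa; [k] numbers the columns crossed from
    there and [i] the rows of unit squares. *)
Definition orbit_sum (R : realType) (g : R -> R -> R) (N M : nat) (alpha y : R) : R :=
  \sum_(k < N) \sum_(i < M) g alpha (y + alpha * k%:R - i%:R).

(** The time window runs between the crossings of the abscissas [m] and [m + N], so it contains
    whole chords only; [y] is the entry height up to the integer [n]. The two bounds on [y] keep the
    orbit within [M] rows. *)
Lemma orbit_integral (R : realType) (S : set (R * R)) (g : R -> R -> R)
    (alpha : R) (x : R * R) (m n : int) (M N : nat) :
  S `<=` @unit_square R -> chord_length S g -> 0 < alpha -> measurable S ->
  let y := x.2 + alpha * (m%:~R - x.1) - n%:~R in
  0 <= y -> y + alpha * N%:R < M%:R ->
  \int[lebesgue_measure]_(t in `[m%:~R - x.1, m%:~R + N%:R - x.1])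
    \1_S (rotation alpha x t) = orbit_sum g N M alpha y.
Proof.
move=> Ssq gS a0 mS y y0 yM.
(* The right endpoint is dropped because there the shifted abscissa equals [N], outside the strict
   range of [indic_frac_sum]. *)
rewrite -Rintegral_itv_bndo_bndc; last exact: integrable_indic_rotation.
set D := [set` _].
have mD : measurable D by exact: measurable_itv.
have chordE (k : 'I_N) (i : 'I_M) : exists lo hi : R,
    [/\ forall t, \1_S (x.1 + t - m%:~R - k%:R, x.2 + alpha * t - n%:~R - i%:R)
         = \1_(`[lo, hi]) t :> R,
     `[lo, hi] `<=` D &
     g alpha (y + alpha * k%:R - i%:R) = Num.max 0 (hi - lo)].
  have [lo [hi [H1 H2]]] := gS _ (y + alpha * k%:R - i%:R) a0.
  (* [c] is the time at which the orbit enters column [k]. *)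
  pose c := m%:~R + k%:R - x.1.
  have E t : S (x.1 + t - m%:~R - k%:R, x.2 + alpha * t - n%:~R - i%:R) <->
      (lo + c <= t <= hi + c).
    have -> : (x.1 + t - m%:~R - k%:R, x.2 + alpha * t - n%:~R - i%:R) =
      (t - c, (y + alpha * k%:R - i%:R) + alpha * (t - c)).
      by congr pair; rewrite /y /c; ring.
    rewrite H1; split => /andP[h1 h2]; apply/andP; split; lra.
  exists (lo + c), (hi + c); split.
  - move=> t; rewrite !indicE; congr (_%:R : R); congr nat_of_bool.
    apply/idP/idP; first by rewrite !inE /= in_itv /= => /E.
    by rewrite !inE /= in_itv /= => /E.
  - move=> t; rewrite /D /= !in_itv /= => /E /Ssq [] /=; rewrite !in_itv /= => /andP[h1 h2] _.
    have : k%:R + 1 <= N%:R :> R by rewrite natr1 ler_nat.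
    have : 0 <= k%:R :> R by [].
    move=> *; apply/andP; split; lra.
  - by rewrite H2; congr Num.max; ring.
transitivity (\int[lebesgue_measure]_(t in D) \sum_(k < N) \sum_(i < M)
  \1_S (x.1 + t - m%:~R - k%:R, x.2 + alpha * t - n%:~R - i%:R) : R).
  apply: eq_Rintegral => t; rewrite inE /D /= in_itv /= => /andP[t1 t2].
  rewrite /rotation (@indic_frac_sum _ _ _ _ m n N M) //.
    by apply/andP; split; lra.
  have h1 : alpha * (m%:~R - x.1) <= alpha * t by rewrite ler_pM2l.
  have h2 : alpha * t < alpha * (m%:~R + N%:R - x.1) by rewrite ltr_pM2l.
  rewrite /y in y0 yM.
  by apply/andP; split; lra.
have intg (k : 'I_N) (i : 'I_M) : (@lebesgue_measure R).-integrable D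
   (EFin \o (fun t => \1_S (x.1 + t - m%:~R - k%:R, x.2 + alpha * t - n%:~R - i%:R))).
  have [lo [hi [H1 H2 H3]]] := chordE k i.
  rewrite (_ : (fun t => _) = \1_(`[lo, hi]) \o id); last by apply/funext.
  apply: integrable_indic_comp; first exact: lebesgue_measure_itv_bnd_fin.
  exact: measurable_indic.
rewrite Rintegral_sum //; last first.
  move=> k; rewrite (_ : _ \o _ = fun t => (\sum_(i < M)
    (\1_S (x.1 + t - m%:~R - k%:R, x.2 + alpha * t - n%:~R - i%:R) : R)%:E)%E).
    by apply: integrable_sum => // i _; exact: (intg k i).
  by apply/funext => t /=; rewrite sumEFin.
apply: eq_bigr => k _; rewrite Rintegral_sum //; apply: eq_bigr => i _.
have [lo [hi [H1 H2 ->]]] := chordE k i.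
under eq_Rintegral do rewrite H1.
rewrite /Rintegral integral_indic // setIidl //.
rewrite -[LHS]/(fine (@lebesgue_measure R (`[lo, hi]%classic : set R))).
rewrite lebesgue_measure_itv /= lte_fin.
rewrite maxEle; case: ltP => h; case: leP => h' //=; lra.
Qed.

(** * Slopes close to a rational one *)

(** For positive [theta], climb from [z] in steps of [theta]: the last point not beyond the next
    integer is within one step of it. A negative [theta] is reduced to this by changing signs. *)
Lemma exists_drift (R : realType) (z theta : R) : theta != 0 ->
  exists (k : nat) (n : int), `|z + k%:R * theta - n%:~R| <= `|theta|.
Proof.
wlog t0 : z theta / 0 < theta => [wl th0|_].
  have [t0|t0|/eqP] := ltrgtP theta 0; last by rewrite (negbTE th0).
    have Nt0 : 0 < - theta by rewrite oppr_gt0.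
    have [k [n kn]] := wl (- z) _ Nt0 (lt0r_neq0 Nt0).
    exists k, (- n); rewrite -(normrN theta).
    rewrite (_ : z + _ - _ = - (- z + k%:R * - theta - n%:~R)) ?[`|- (_ - _)|]normrN //.
    by rewrite rmorphN /=; ring.
  exact: wl.
have zc := ceil_ge z; set c := Num.ceil z in zc.
have /truncn_itv : 0 <= (c%:~R - z) / theta by apply: divr_ge0; lra.
set k := Num.truncn _; rewrite ler_pdivlMr // ltr_pdivrMr // -natr1 => /andP[h1 h2].
exists k, c; rewrite ler0_norm ?gtr0_norm //; lra.
Qed.

Lemma discrepancy_sub (R : realType) (S : set (R * R)) (alpha : R) (x : R * R) (a b : R) :
  measurable S -> 0 <= a -> a <= b ->
  discrepancy S alpha x b - discrepancy S alpha x a =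
  \int[lebesgue_measure]_(t in `[a, b]) \1_S (rotation alpha x t) - (b - a) * area S.
Proof.
move=> mS a0 ab.
rewrite -Rintegral_itv_obnd_cbnd; last exact: integrable_indic_rotation.
rewrite -(@Rintegral_itvB _ _ (BLeft 0) (BRight b)) /discrepancy ?bnd_simp //.
  by ring.
exact: integrable_indic_rotation.
Qed.

Lemma cvg_orbit_sum (R : realType) (g : R -> R -> R) (N M : nat) (alpha y : R) :
  (forall z, g p.1 p.2 @[p --> (alpha, z)] --> g alpha z) ->
  orbit_sum g N M p.1 p.2 @[p --> (alpha, y)] --> orbit_sum g N M alpha y.
Proof.
move=> cg; rewrite /orbit_sum.
apply: (@cvg_big _ _ _ 0 _ (@add_continuous R)) => k _.
apply: (@cvg_big _ _ _ 0 _ (@add_continuous R)) => i _.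
apply: (@cvg_comp _ _ _ (fun p : R * R => (p.1, p.2 + p.1 * k%:R - i%:R))
  (fun p : R * R => g p.1 p.2) _ (nbhs (alpha, y + alpha * k%:R - i%:R)) _ _ (cg _)).
apply: (@cvg_pair _ _ _ _ (nbhs alpha) (nbhs (y + alpha * k%:R - i%:R))); first exact: cvg_fst.
apply: cvgB; last exact: cvg_cst.
apply: cvgD; first exact: cvg_snd.
by apply: cvgMl; exact: cvg_fst.
Qed.

(** Over a block of [q] unit steps the entry height moves, modulo 1, only by
    [theta = q (alpha - alpha0)]. Some block starts near [y0], and each of the next [L] blocks
    changes the discrepancy by nearly the same nonzero amount. Here [delta] does not depend on the
    starting point. *)
Lemma discrepancy_unbounded_near (R : realType) (S : set (R * R))
    (g : R -> R -> R) (p q M : nat) (y0 : R) :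
  measurable S -> S `<=` @unit_square R -> chord_length S g ->
  (0 < p)%N -> (0 < q)%N ->
  let alpha0 : R := p%:R / q%:R in
  (forall z, g u.1 u.2 @[u --> (alpha0, z)] --> g alpha0 z) ->
  0 < y0 -> y0 + alpha0 * q%:R < M%:R ->
  orbit_sum g q M alpha0 y0 <> q%:R * area S ->
  forall C : R, exists2 delta : R, 0 < delta &
    forall alpha : R, alpha != alpha0 -> `|alpha - alpha0| < delta ->
    forall x : R * R, @unit_square R x ->
    exists2 T : R, 0 < T & C < `|discrepancy S alpha x T|.
Proof.
move=> mS Ssq gS p0 q0 alpha0 cg y00 yM neq C.
have qR : 0 < q%:R :> R by rewrite ltr0n.
have pR : 0 < p%:R :> R by rewrite ltr0n.
have a00 : 0 < alpha0 by rewrite divr_gt0.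
have qa0 : q%:R * alpha0 = p%:R by rewrite /alpha0; field; lra.
(* The gain of discrepancy over one period at slope [alpha0] from height [y0]. *)
pose V := orbit_sum g q M alpha0 y0 - q%:R * area S.
have V0 : 0 < `|V| by rewrite normr_gt0 subr_eq0; apply/eqP.
have /cvgrPdist_lt /(_ (`|V| / 2)) := @cvg_orbit_sum _ g q M alpha0 y0 cg.
rewrite divr_gt0 // => /(_ isT) /nbhs_ballP [e /= e0 He].
pose s := M%:R - (y0 + alpha0 * q%:R).
have s0 : 0 < s by rewrite subr_gt0.
(* Besides continuity, [e'] must keep the heights nonnegative and below the top row: one half of [s]
   absorbs the drift of the height, the other the change of slope. *)
pose e' := Num.min e (Num.min y0 (s / 2)).
have e'0 : 0 < e' by rewrite !lt_min e0 y00 divr_gt0.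
have [e'e e'y e's] : [/\ e' <= e, e' <= y0 & e' <= s / 2].
  by rewrite /e' !ge_min !lexx !orbT.
clearbody e'.
(* [L] blocks, each gaining at least [|V| / 2] in the direction of [V], move the discrepancy by more
   than [2 * C]. *)
pose L := (Num.truncn (4 * C / `|V|)).+1.
have HL : 4 * C < L%:R * `|V|.
  by rewrite -ltr_pdivrMr // truncnS_gt.
(* The three bounds give closeness of slopes, positivity of [alpha], and room for [L + 1] drifts by
   [theta], one of them for the initial error of [exists_drift]. *)
pose delta := Num.min e' (Num.min alpha0 (e' / (q%:R * (L%:R + 1)))).
have L0 : 0 < L%:R + 1 :> R by rewrite ltr_wpDl.
have delta0 : 0 < delta by rewrite !lt_min e'0 a00 divr_gt0 // mulr_gt0.
have [de da dq] : [/\ delta <= e', delta <= alpha0 & delta * (q%:R * (L%:R + 1)) <= e'].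
  rewrite -ler_pdivlMr ?mulr_gt0 //.
  by rewrite /delta !ge_min !lexx !orbT.
exists delta => // alpha aN ad x sqx.
have a0 : 0 < alpha by move: ad; rewrite ltr_norml => /andP[]; lra.
pose theta := q%:R * (alpha - alpha0).
have th0 : theta != 0 by rewrite mulf_eq0 negb_or (lt0r_neq0 qR) subr_eq0.
have thE : `|theta| = q%:R * `|alpha - alpha0| by rewrite normrM gtr0_norm.
have thL : `|theta| * (L%:R + 1) < e'.
  apply: lt_le_trans dq.
  by rewrite thE (mulrC q%:R) -mulrA ltr_pM2r // mulr_gt0.
have [x10 x11] : 0 <= x.1 /\ x.1 < 1.
  by case: sqx => /=; rewrite in_itv /= => /andP[].
(* Height at time [1 - x.1], the first crossing of an integer abscissa at positive time. *)
pose y1 := x.2 + alpha * (1 - x.1).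
have [k [n kn]] := exists_drift (y1 - y0) th0.
(* Block [l] starts at abscissa [m l], after [k] periods spent drifting towards [y0]. *)
pose m l := (1 + (k + l) * q)%N.
pose T l : R := (m l)%:R - x.1.
have T0 l : 0 < T l.
  by rewrite /T /m natrD; have : 0 <= ((k + l) * q)%:R :> R by []; lra.
apply: contrapT => noT.
have bnd l : `|discrepancy S alpha x (T l)| <= C.
  by rewrite leNgt; apply/negP => h; apply: noT; exists (T l).
have step l : (l < L)%N ->
  `|discrepancy S alpha x (T l.+1) - discrepancy S alpha x (T l) - V| <= `|V| / 2.
  move=> lL.
  have TS : T l.+1 = (m l)%:R + q%:R - x.1.
    rewrite /T -natrD (_ : m l.+1 = (m l + q)%N) //.
    by rewrite /m addnS mulSn (addnC q) addnA.
  rewrite discrepancy_sub ?(ltW (T0 l)) //; last by rewrite TS /T; lra.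
  have -> : T l.+1 - T l = q%:R by rewrite TS /T; ring.
  (* A period at slope [alpha0] climbs exactly [p] rows, hence [(k + l) * p]. *)
  pose nl : int := ((k + l) * p)%N%:Z + n.
  pose y := x.2 + alpha * ((m l)%:Z%:~R - x.1) - nl%:~R.
  have yE : y - y0 = (y1 - y0 + k%:R * theta - n%:~R) + l%:R * theta.
    rewrite /y /nl /y1 /theta rmorphD /= -!pmulrn /m !natrD !natrM natrD.
    by rewrite -qa0; ring.
  have yy0 : `|y - y0| < e'.
    rewrite yE; apply: le_lt_trans thL; apply: le_trans (ler_normD _ _) _.
    rewrite mulrDr mulr1 addrC lerD // normrM normr_nat mulrC ler_wpM2l //.
    by rewrite ler_nat ltnW.
  have thle : `|theta| <= e'.
    apply: ltW; apply: le_lt_trans thL; rewrite ler_peMr //.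
    by rewrite lerDr.
  have := yy0; rewrite ltr_norml => /andP[y_ge y_lt].
  have : theta <= e' by apply: le_trans thle; exact: ler_norm.
  rewrite /theta => thle'.
  have := @orbit_integral R S g alpha x (m l)%:Z nl M q Ssq gS a0 mS.
  rewrite -/y /= -pmulrn. rewrite -TS -/(T l) => ->; [|by lra|].
    rewrite /V; set F := orbit_sum _ _ _ alpha _; set F0 := orbit_sum _ _ _ _ _.
    rewrite (_ : _ - _ - _ = - (F0 - F)); last by ring.
    rewrite normrN ltW //; apply: (He (alpha, y)); split => /=.
      by rewrite -ball_normE /= distrC; apply: lt_le_trans ad _; exact: le_trans de _.
    by rewrite -ball_normE /= distrC; apply: lt_le_trans yy0 _.
  by rewrite /s in e's; lra.
have telescope l : (l <= L)%N ->
  `|discrepancy S alpha x (T l) - discrepancy S alpha x (T 0%N) - l%:R * V|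
     <= l%:R * (`|V| / 2).
  elim: l => [|l IH] lL; first by rewrite !mul0r subrr subr0 normr0.
  have := lerD (IH (ltnW lL)) (step l lL).
  rewrite -[X in _ <= _ + X]mul1r -mulrDl natr1 => h.
  apply: le_trans (le_trans (ler_normD _ _) h).
  rewrite -natr1 le_eqVlt; apply/orP; left; apply/eqP; congr `|_|; ring.
have := telescope L (leqnn _).
have := bnd L; have := bnd 0%N.
move: (discrepancy _ _ _ _) (discrepancy _ _ _ _) => dL d0.
move=> h0 hL h.
have : L%:R * `|V| <= `|d0| + `|dL| + L%:R * (`|V| / 2).
  rewrite -[X in X * _ <= _](@normr_nat R L) -normrM.
  have -> : L%:R * V = - d0 + dL - (dL - d0 - L%:R * V) by ring.
  rewrite -(normrN d0); apply: le_trans (ler_normB _ _) _.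
  by apply: lerD h; exact: ler_normD.
lra.
Qed.

(** * Generic slopes *)

(** Were the set countable, it could be enumerated together with the rationals. Removing the [n]-th
    point from the interior of the [n]-th condition leaves a dense open set, and a Baire point of
    []0, 1[] lies in all of these: it satisfies every [P n] and yet is not enumerated. *)
Lemma uncountable_generic (R : realType) (P : nat -> R -> Prop) :
  (forall (n : nat) (a b : R), 0 <= a -> a < b -> exists c d : R, [/\ a <= c, c < d, d <= b &
     forall alpha : R, c < alpha -> alpha < d -> P n alpha]) ->
  ~ countable [set alpha : R | [/\ 0 < alpha, irrational alpha & forall n, P n alpha]].
Proof.
move=> HP cE; set E := [set alpha : R | _] in cE.
have cEQ : countable (E `|` @rational R).
  rewrite -bigcup2E; apply: bigcup_countable => // -[|[|n]] _ //=.
  by apply: (card_le_trans (card_image_le _ _)); exact: countableP.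
have /countable_injP [f injf] := cEQ.
(* Off the range of [f] a default value is enumerated, which only excludes one more point. *)
pose e n : R := 'pinv_(fun=> 0) (E `|` @rational R) f n.
(* The guard [0 < beta] puts all negative numbers into [U n], so that it is dense in the whole
   line. *)
pose U n := interior [set beta : R | 0 < beta -> P n beta].
have oU n : open (U n) by exact: open_interior.
have oC n : open (~` [set e n]).
  rewrite openC.
  exact/accessible_closed_set1/hausdorff_accessible/Rhausdorff.
have dU n : dense (U n).
  move=> O [z Oz] oO.
  have [z0|z0] := ltP z 0.
    exists z; split => //; rewrite /U /interior.
    have : z \in `]-oo, 0[ by rewrite in_itv.
    move/near_in_itvNyo; apply: filterS => y; rewrite in_itv /= => y0 y0'.
    by have := lt_trans y0 y0'; rewrite ltxx.
  have /nbhs_ballP [r /= r0 rO] : nbhs z O by exact: open_nbhs_nbhs.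
  have [|c [d [ac cd db cdP]]] := HP n z (z + r) z0; first by rewrite ltrDl.
  have [cm md] := midf_lt cd; set m := (c + d) / 2 in cm md.
  exists m; split.
    by apply: rO; rewrite -ball_normE /= ltr0_norm ?subr_lt0; lra.
  rewrite /U /interior; have : m \in `]c, d[ by rewrite in_itv /= cm md.
  move/near_in_itvoo; apply: filterS => y; rewrite in_itv /= => /andP[cy yd] _.
  exact: cdP.
have /Baire : forall n, open (U n `&` ~` [set e n]) /\ dense (U n `&` ~` [set e n]).
  move=> n; split; first exact: openI.
  by apply: denseI => //; exact: dense_set1C.
move=> /(_ `]0, 1[%classic) [||alpha []].
- by exists (1 / 2); rewrite /= in_itv /=; apply/andP; split; lra.
- exact: itv_open.
rewrite /= in_itv /= => /andP[alpha0 _] UC.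
have nE : ~ (E `|` @rational R) alpha.
  move=> Ea; have [_] := UC (f alpha) I; apply.
  by rewrite /= /e pinvKV ?inE.
apply: (nE); left; split => //; first by move=> qa; apply: nE; right.
by move=> n; have [/interior_subset /(_ alpha0)] := UC n I.
Qed.

(** Odd numerators over a fixed odd [q] lie [2 / q] apart, so any odd [q] with [q * (b - a) > 2]
    works. *)
Lemma odd_fraction_between (R : realType) (a b : R) : 0 <= a -> a < b ->
  exists p q : nat, [/\ odd p, odd q & a < p%:R / q%:R < b].
Proof.
move=> a0 ab.
pose Q := (Num.truncn (2 / (b - a))).+1.
pose q := (2 * Q + 1)%N.
have oq : odd q by rewrite /q oddD oddM.
have qR : 0 < q%:R :> R by rewrite ltr0n /q addn1.
have HQ : 2 < Q%:R * (b - a) by rewrite -ltr_pdivrMr ?subr_gt0 // truncnS_gt.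
have qQ : Q%:R <= q%:R :> R by rewrite ler_nat /q; lia.
have Hq : 2 < q%:R * (b - a).
  by apply: lt_le_trans HQ _; rewrite ler_pM2r // subr_gt0.
clearbody q.
have w0 : 0 <= (a * q%:R + 1) / 2 by rewrite divr_ge0 // addr_ge0 // mulr_ge0.
(* [2 * P + 1] is the least odd number above [a * q]. *)
have /andP[] := truncn_itv w0; set P := Num.truncn _; rewrite -(natr1 P) => h1 h2.
exists (2 * P + 1)%N, q; split; [by rewrite oddD oddM|exact: oq|].
rewrite ltr_pdivlMr // ltr_pdivrMr // natrD natrM; apply/andP; split; lra.
Qed.

Lemma uncountable_unbounded_slopes (R : realType) (S : set (R * R)) (g : R -> R -> R) :
  measurable S -> S `<=` @unit_square R -> chord_length S g ->
  (forall alpha z : R, 0 < alpha -> g u.1 u.2 @[u --> (alpha, z)] --> g alpha z) ->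
  (forall p q : nat, odd p -> odd q -> exists (M : nat) (y0 : R),
    let alpha := p%:R / q%:R in
    [/\ 0 < y0, y0 + alpha * q%:R < M%:R &
        orbit_sum g q M alpha y0 <> q%:R * area S]) ->
  ~ countable [set alpha : R | [/\ 0 < alpha, irrational alpha &
     forall x, @unit_square R x -> ~ bounded_remainder_set S alpha x]].
Proof.
move=> mS Ssq gS cg HS.
pose P (n : nat) (alpha : R) := forall x, @unit_square R x ->
  exists2 T : R, 0 < T & n%:R < `|discrepancy S alpha x T|.
move=> cS; apply: (@uncountable_generic R P).
  move=> n a b a0 ab; have [p [q [op oq /andP[aal alb]]]] := odd_fraction_between a0 ab.
  have [M [y0 [y00 yM neq]]] := HS p q op oq.
  have p0 := odd_gt0 op; have q0 := odd_gt0 oq.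
  have al0 : 0 < p%:R / q%:R :> R by rewrite divr_gt0 ?ltr0n.
  have [d d0 Hd] := discrepancy_unbounded_near mS Ssq gS p0 q0
    (fun z => cg _ z al0) y00 yM neq n%:R.
  (* The open interval starts at [p / q] without containing it: the drift needs a slope different
     from [p / q]. *)
  exists (p%:R / q%:R), (Num.min b (p%:R / q%:R + d)); split.
  - exact: ltW.
  - by rewrite lt_min alb ltrDl.
  - by rewrite ge_min lexx.
  - move=> alpha h; rewrite lt_min => /andP[_ h'] x sqx.
    apply: Hd => //; first by rewrite gt_eqF.
    by rewrite gtr0_norm ?subr_gt0 // ltrBlDl.
apply: sub_countable cS; apply: subset_card_le => alpha [a0 ia Pa]; split => // x sqx [C HC].
have [T T0] := Pa (Num.truncn C).+1 x sqx.
apply/negP; rewrite -leNgt; apply: (le_trans (HC T T0)).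
exact: ltW (truncnS_gt C).
Qed.

(** * The triangle *)

Lemma right_triangleP (R : realType) (c : R) (p : R * R) : 0 < c ->
  triangle (0, 0) (c, 0) (0, c) p <-> [/\ 0 <= p.1, 0 <= p.2 & p.1 + p.2 <= c].
Proof.
move=> c0; split=> [[u [v [w [u0 v0 w0 uvw ->]]]]|[p1 p2 pc]] /=.
  have h : 0 <= u * c by rewrite mulr_ge0 // ltW.
  rewrite !mulr0 !add0r ?addr0; split; rewrite ?mulr_ge0 ?(ltW c0) //.
  have -> : v * c + w * c = (u + v + w) * c - u * c by ring.
  by rewrite uvw; lra.
exists (1 - p.1 / c - p.2 / c), (p.1 / c), (p.2 / c); split.
- by rewrite -addrA -opprD subr_ge0 -mulrDl ler_pdivrMr // mul1r.
- by rewrite divr_ge0 // ltW.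
- by rewrite divr_ge0 // ltW.
- by ring.
- by rewrite [LHS]surjective_pairing; congr pair => /=; field; rewrite gt_eqF.
Qed.

(** In [z] this is a piecewise linear hat with kinks at [- alpha / 2], [0] and [1 / 2], where the
    line passes through a vertex. *)
Definition triangle_chord (R : realType) (alpha z : R) : R :=
  Num.max 0 ((1 / 2 - z) / (1 + alpha) - Num.max 0 (- z / alpha)).

(** The half size puts the closed triangle inside the half-open square and, for odd [p] and [q], the
    outer kinks off the multiples of [1 / q]. No edge has positive slope. *)
Definition half_triangle (R : realType) : set (R * R) :=
  triangle (0, 0) (1 / 2, 0) (0, 1 / 2).

Lemma chord_length_half_triangle (R : realType) :
  chord_length (@half_triangle R) (@triangle_chord R).
Proof.
move=> alpha z a0; have a10 : 0 < 1 + alpha by lra.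
exists (Num.max 0 (- z / alpha)), ((1 / 2 - z) / (1 + alpha)); split => // t.
have c0 : 0 < 1 / 2 :> R by lra.
apply: (iff_trans (right_triangleP _ c0)) => /=; rewrite ge_max (ler_pdivrMr _ _ a0) (ler_pdivlMr _ _ a10).
split=> [[h1 h2 h3]|/andP[/andP[h1 h2] h3]].
  by rewrite h1 /=; apply/andP; split; lra.
by split => //; lra.
Qed.

Lemma cvg_triangle_chord (R : realType) (alpha z : R) : 0 < alpha ->
  triangle_chord u.1 u.2 @[u --> (alpha, z)] --> triangle_chord alpha z.
Proof.
move=> a0; rewrite /triangle_chord.
have maxc (f g : R * R -> R) a b : f u @[u --> (alpha, z)] --> a ->
    g u @[u --> (alpha, z)] --> b ->
    Num.max (f u) (g u) @[u --> (alpha, z)] --> Num.max a b.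
  move=> fa gb; apply: continuous2_cvg fa gb; exact: max_continuous (a, b).
have c1 : u.1 @[u --> (alpha, z)] --> alpha by exact: cvg_fst.
have c2 : u.2 @[u --> (alpha, z)] --> z by exact: cvg_snd.
apply: (maxc); first exact: cvg_cst.
apply: cvgB.
  apply: cvgM; first by apply: cvgB => //; exact: cvg_cst.
  by apply: cvgV; [rewrite gt_eqF //; lra|apply: cvgD => //; exact: cvg_cst].
apply: (maxc); first exact: cvg_cst.
apply: cvgM; first exact: cvgN.
by apply: cvgV => //; rewrite gt_eqF.
Qed.

Lemma triangle_chord_right (R : realType) (alpha z : R) : 0 < alpha ->
  0 <= z <= 1 / 2 -> triangle_chord alpha z = (1 / 2 - z) / (1 + alpha).
Proof.
move=> a0 /andP[z0 z1]; rewrite /triangle_chord.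
rewrite [X in _ - X]max_l ?subr0 ?max_r //.
  by rewrite divr_ge0; lra.
by rewrite mulNr oppr_le0 divr_ge0 // ltW.
Qed.

Lemma triangle_chord_left (R : realType) (alpha z : R) : 0 < alpha ->
  - (alpha / 2) <= z <= 0 ->
  triangle_chord alpha z = (alpha / 2 + z) / (alpha * (1 + alpha)).
Proof.
move=> a0 /andP[z0 z1]; rewrite /triangle_chord.
have aa0 : 0 < alpha * (1 + alpha) by rewrite mulr_gt0 //; lra.
have E : (1 / 2 - z) / (1 + alpha) - - z / alpha = (alpha / 2 + z) / (alpha * (1 + alpha)).
  by field; rewrite !gt_eqF //; lra.
rewrite [X in _ - X]max_r ?E ?max_r //.
  by rewrite divr_ge0 ?(ltW aa0) //; lra.
by rewrite divr_ge0 ?(ltW a0) //; lra.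
Qed.

Lemma triangle_chord_out (R : realType) (alpha z : R) : 0 < alpha ->
  z <= - (alpha / 2) \/ 1 / 2 <= z -> triangle_chord alpha z = 0.
Proof.
move=> a0 h; rewrite /triangle_chord max_l // subr_le0 le_max.
have a10 : 0 < 1 + alpha by lra.
have aa0 : 0 < alpha * (1 + alpha) by rewrite mulr_gt0 //; lra.
case: h => h; last by rewrite ler_pdivrMr // mul0r subr_le0 h.
apply/orP; right; rewrite -subr_ge0.
have -> : - z / alpha - (1 / 2 - z) / (1 + alpha) = - (alpha / 2 + z) / (alpha * (1 + alpha)).
  by field; rewrite !gt_eqF //; lra.
by rewrite divr_ge0 ?(ltW aa0) //; lra.
Qed.

(* On the step z in (1/q)Z the kinks -alpha/2 and 1/2 of the chord length fall
   on the half-step grid points z +- h because p and q are odd, so that only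
   the concave kink at 0 contributes to the second difference. *)
Lemma triangle_chord_second_difference (R : realType) (p q : nat) (n : int) :
  odd p -> odd q ->
  let alpha : R := p%:R / q%:R in let h := (2 * q%:R)^-1 in
  let z := n%:~R / q%:R in
  triangle_chord alpha (z + h) + triangle_chord alpha (z - h)
    - 2 * triangle_chord alpha z = if n == 0 then - (h / alpha) else 0.
Proof.
move=> op oq alpha h z.
have q0 : 0 < q%:R :> R by rewrite ltr0n odd_gt0.
have p0 : 0 < p%:R :> R by rewrite ltr0n odd_gt0.
have a0 : 0 < alpha by rewrite divr_gt0.
have h0 : 0 < h by rewrite invr_gt0 mulr_gt0.
have hq : 1 / 2 = q%:R * h by rewrite /h; field; lra.
have hp : alpha / 2 = p%:R * h by rewrite /alpha /h; field; lra.
have hz : z = 2 * n%:~R * h by rewrite /z /h; field; lra.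
have lin (m m' : int) : (m <= m')%R -> m%:~R * h <= m'%:~R * h.
  by move=> mm; rewrite ler_pM2r // ler_int.
have zp : z + h = (2 * n + 1)%:~R * h by rewrite hz rmorphD rmorphM /=; ring.
have zm : z - h = (2 * n - 1)%:~R * h by rewrite hz rmorphB rmorphM /=; ring.
have pz : p%:R = p%:Z%:~R :> R by [].
have qz : q%:R = q%:Z%:~R :> R by [].
have [Po|Po] : (2 * n + 1 <= - p%:Z)%R \/ (- p%:Z <= 2 * n - 1)%R by lia.
  have n0 : n == 0 = false by apply/eqP; lia.
  have := lin _ _ Po; rewrite -zp rmorphN /= -pz => le1.
  by rewrite n0 !triangle_chord_out //; [ring|left; lra..].
have := lin _ _ Po; rewrite -zm rmorphN /= -pz => le1.
have [Qo|Qo] : (q%:Z <= 2 * n - 1)%R \/ (2 * n + 1 <= q%:Z)%R by lia.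
  have n0 : n == 0 = false by apply/eqP; lia.
  have := lin _ _ Qo; rewrite -zm -qz => le2.
  by rewrite n0 !triangle_chord_out //; [ring|right; lra..].
have := lin _ _ Qo; rewrite -zp -qz => le2.
have [n0|n0|n0] := ltrgtP n 0.
- have : (2 * n + 1 <= 0)%R by lia.
  move/lin; rewrite -zp mul0r => le3.
  rewrite !triangle_chord_left //; [ring|apply/andP; split; lra..].
- have : (0 <= 2 * n - 1)%R by lia.
  move/lin; rewrite -zm mul0r => le3.
  rewrite !triangle_chord_right //; [ring|apply/andP; split; lra..].
- have z0 : z = 0 by rewrite /z n0 mul0r.
  rewrite (@triangle_chord_left _ _ (z - h)) ?(@triangle_chord_right _ _ z)
    ?(@triangle_chord_right _ _ (z + h)) //; [|apply/andP; split; lra..].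
  by rewrite z0; field; rewrite !gt_eqF //; lra.
Qed.

(** If the orbit sum equalled [V] at all heights in []0, 2[], its second difference at [1] with step
    [h] would vanish. But that is a sum of second differences of the chord length, none positive,
    and one of them is centred at the kink [0] and negative. *)
Lemma orbit_sum_triangle_chord_neq (R : realType) (p q : nat) (V : R) :
  odd p -> odd q -> exists (M : nat) (y0 : R), let alpha := p%:R / q%:R in
    [/\ 0 < y0, y0 + alpha * q%:R < M%:R &
        orbit_sum (@triangle_chord R) q M alpha y0 <> V].
Proof.
move=> op oq.
have q0 : 0 < q%:R :> R by rewrite ltr0n odd_gt0.
have q1 : 1 <= q%:R :> R by rewrite ler1n odd_gt0.
have p0 : 0 < p%:R :> R by rewrite ltr0n odd_gt0.
pose alpha : R := p%:R / q%:R.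
have a0 : 0 < alpha by rewrite divr_gt0.
have aq : alpha * q%:R = p%:R by rewrite divfK // gt_eqF.
pose h : R := (2 * q%:R)^-1.
have h0 : 0 < h by rewrite invr_gt0 mulr_gt0.
have h1 : h < 1 by rewrite invf_lt1 ?mulr_gt0 //; lra.
(* Heights below [2] rise by [alpha * q = p] over a period, so [p + 3] rows suffice. *)
exists (p + 3)%N; apply: contrapT => none.
pose f y := orbit_sum (@triangle_chord R) q (p + 3) alpha y.
have fV y : 0 < y -> y < 2 -> f y = V.
  move=> y0 y2; apply: contrapT => neq; apply: none; exists y; split => //.
  by rewrite -/alpha aq natrD; lra.
have fh : f (1 + h) = V by apply: fV; lra.
have fm : f (1 - h) = V by apply: fV; lra.
have f1 : f 1 = V by apply: fV; lra.
pose n (k i : nat) : int := q%:Z + p%:Z * k%:Z - q%:Z * i%:Z.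
pose D (k i : nat) : R := if n k i == 0 then h / alpha else 0.
have D0 k i : 0 <= D k i by rewrite /D; case: ifP => // _; rewrite divr_ge0 // ltW.
have : \sum_(k < q) \sum_(i < p + 3) D k i = 0.
  transitivity (2 * f 1 - (f (1 + h) + f (1 - h))); last by rewrite fh fm f1; ring.
  rewrite /f /orbit_sum mulr_sumr -big_split -sumrB; apply: eq_bigr => k _ /=.
  rewrite mulr_sumr -big_split -sumrB; apply: eq_bigr => i _ /=.
  have zE : 1 + alpha * k%:R - i%:R = (n k i)%:~R / q%:R.
    rewrite /n rmorphB rmorphD !rmorphM /= -!pmulrn /alpha; field.
    by rewrite gt_eqF.
  have -> : 1 + h + alpha * k%:R - i%:R = (n k i)%:~R / q%:R + h by rewrite -zE; ring.
  have -> : 1 - h + alpha * k%:R - i%:R = (n k i)%:~R / q%:R - h by rewrite -zE; ring.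
  rewrite zE.
  have := @triangle_chord_second_difference R p q (n k i) op oq.
  rewrite /= -/alpha -/h /D => sd.
  by move: sd; case: ifP => _ sd; lra.
have i1 : (1 < p + 3)%N by rewrite addn3.
have S0 k : 0 <= \sum_(i < p + 3) D k i by apply: sumr_ge0 => i _.
move=> /psumr_eq0P E1.
have {E1} /psumr_eq0P E2 := E1 (fun k _ => S0 k) (Ordinal (odd_gt0 oq)) isT.
have /eqP := E2 (fun i _ => D0 _ i) (Ordinal i1) isT.
(* At height [1] the line of column [0] passes through the corner of the triangle in row [1]. *)
have n0 : n 0%N 1%N == 0 by apply/eqP; rewrite /n; lia.
by rewrite /D /= n0 gt_eqF // divr_gt0.
Qed.

Lemma half_triangle_sub (R : realType) : @half_triangle R `<=` @unit_square R.
Proof.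
move=> p; have c0 : 0 < 1 / 2 :> R by lra.
move/(right_triangleP _ c0) => [p1 p2 p12].
by split; rewrite /= in_itv /=; apply/andP; split; lra.
Qed.

Lemma half_triangle_not_collinear (R : realType) :
  ~ collinear (0, 0) (1 / 2, 0) (0, 1 / 2 : R).
Proof. by rewrite /collinear /= => h; lra. Qed.

Lemma uncountable_triangle (R : realType) :
  ~ countable [set alpha : R | [/\ 0 < alpha, irrational alpha &
        exists a b c : R * R,
          [/\ ~ collinear a b c,
              triangle a b c `<=` @unit_square R,
              [/\ ~ has_slope a b alpha, ~ has_slope b c alpha &
                  ~ has_slope c a alpha] &
              forall x : R * R, @unit_square R x ->
                ~ bounded_remainder_set (triangle a b c) alpha x]]].
Proof.
move=> cS.
have mS : measurable (@half_triangle R).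
  by apply: measurable_triangle; exact: half_triangle_not_collinear.
apply: (@uncountable_unbounded_slopes R (@half_triangle R) (@triangle_chord R) mS
  (@half_triangle_sub R) (@chord_length_half_triangle R) (@cvg_triangle_chord R)).
  by move=> p q op oq; exact: orbit_sum_triangle_chord_neq.
apply: sub_countable cS; apply: subset_card_le => alpha [a0 ia unb]; split => //.
exists (0, 0), (1 / 2, 0), (0, 1 / 2); split => //.
- exact: half_triangle_not_collinear.
- exact: half_triangle_sub.
- split; rewrite /has_slope /=.
  + by move=> [_]; rewrite subrr mul0r => h; lra.
  + move=> [_]; rewrite sub0r subr0 invrN mulrN divff ?gt_eqF // => h; lra.
  + by case.
Qed.

(** * The disc *)

Definition central_disc (R : realType) : set (R * R) := disc (1 / 2, 1 / 2) (1 / 4).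

(** The squared term is the vertical offset of the line from the centre. The square root is [0] on
    negative arguments, as it should be for lines that miss the disc. *)
Definition disc_chord (R : realType) (alpha z : R) : R :=
  2 * Num.sqrt ((1 + alpha ^+ 2) / 16 - (z + alpha / 2 - 1 / 2) ^+ 2) / (1 + alpha ^+ 2).

Lemma central_disc_sub (R : realType) : @central_disc R `<=` @unit_square R.
Proof.
move=> [t u] /= h.
have t2 := sqr_ge0 (t - 1 / 2); have u2 := sqr_ge0 (u - 1 / 2).
rewrite /central_disc /disc /= in h.
by split; rewrite /= in_itv /=; apply/andP; split; nra.
Qed.

Lemma sqr_le_sqrt (R : rcfType) (x d : R) : 0 <= d ->
  (x ^+ 2 <= d) = (- Num.sqrt d <= x <= Num.sqrt d).
Proof. by move=> d0; rewrite -ler_norml -sqrtr_sqr ler_sqrt. Qed.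

Lemma chord_length_central_disc (R : realType) :
  chord_length (@central_disc R) (@disc_chord R).
Proof.
move=> alpha z a0.
pose K := 1 + alpha ^+ 2.
have K0 : 0 < K by rewrite ltr_wpDr // sqr_ge0.
pose w := z + alpha / 2 - 1 / 2.
pose d := K / 16 - w ^+ 2.
(* After multiplication by [K], completing the square in [t] turns the disc inequality into a bound
   on one square. *)
have E t : central_disc (t, z + alpha * t) <-> (K * (t - 1 / 2) + alpha * w) ^+ 2 <= d.
  rewrite /central_disc /disc /=.
  rewrite -(ler_pM2l K0) -subr_ge0 -[X in _ <-> is_true X]subr_ge0.
  suff -> : K * (1 / 4) ^+ 2 - K * ((t - 1 / 2) ^+ 2 + (z + alpha * t - 1 / 2) ^+ 2) =
    d - (K * (t - 1 / 2) + alpha * w) ^+ 2 by [].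
  by rewrite /d /K /w; field.
rewrite /disc_chord -/K -/w -/d.
have [d0|d0] := ltP d 0.
  (* Any [hi < lo] represents the empty chord. *)
  exists 1, 0; split => [t|]; last by rewrite ltr0_sqrtr // mulr0 mul0r max_l //; lra.
  rewrite E; split => [h|/andP[]]; last by lra.
  by have := le_lt_trans (le_trans (sqr_ge0 _) h) d0; rewrite ltxx.
exists (1 / 2 + (- (alpha * w) - Num.sqrt d) / K), (1 / 2 + (- (alpha * w) + Num.sqrt d) / K).
split => [t|]; last first.
  rewrite max_r; last by rewrite subr_ge0 lerD2l ler_pM2r ?invr_gt0 // lerD2l ge0_cp ?sqrtr_ge0.
  by field; rewrite gt_eqF.
have loE x : (1 / 2 + x / K <= t) = (x <= (t - 1 / 2) * K).
  by rewrite -lerBrDl ler_pdivrMr.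
have hiE x : (t <= 1 / 2 + x / K) = ((t - 1 / 2) * K <= x).
  by rewrite -lerBlDl ler_pdivlMr.
rewrite E sqr_le_sqrt // loE hiE.
by split => /andP[h1 h2]; apply/andP; split; lra.
Qed.

Lemma cvg_disc_chord (R : realType) (alpha z : R) : 0 < alpha ->
  disc_chord u.1 u.2 @[u --> (alpha, z)] --> disc_chord alpha z.
Proof.
move=> a0; rewrite /disc_chord.
have c1 : u.1 @[u --> (alpha, z)] --> alpha by exact: cvg_fst.
have c2 : u.2 @[u --> (alpha, z)] --> z by exact: cvg_snd.
have cK : 1 + u.1 ^+ 2 @[u --> (alpha, z)] --> 1 + alpha ^+ 2.
  by apply: cvgD; [exact: cvg_cst|rewrite expr2; under eq_cvg do rewrite expr2; exact: cvgM].
apply: cvgM; last first.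
  by apply: cvgV => //; rewrite gt_eqF // ltr_wpDr // sqr_ge0.
apply: cvgM; first exact: cvg_cst.
apply: (@cvg_comp _ _ _ (fun u : R * R => (1 + u.1 ^+ 2) / 16 - (u.2 + u.1 / 2 - 1 / 2) ^+ 2)
  Num.sqrt _ (nbhs ((1 + alpha ^+ 2) / 16 - (z + alpha / 2 - 1 / 2) ^+ 2))); last exact: sqrt_continuous.
apply: cvgB; first by apply: cvgM => //; exact: cvg_cst.
rewrite expr2; under eq_cvg do rewrite expr2.
have cw : u.2 + u.1 / 2 - 1 / 2 @[u --> (alpha, z)] --> z + alpha / 2 - 1 / 2.
  apply: cvgB; last exact: cvg_cst.
  by apply: cvgD => //; apply: cvgM => //; exact: cvg_cst.
exact: cvgM.
Qed.

(* At u with u ^+ 2 >= a the constant is 1 / 0 = 0, as it should: there the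
   square root vanishes and can only increase. *)
Lemma sqrt_sub_sqr_lower (R : realType) (a u h : R) : 0 <= h <= 1 ->
  - ((2 * `|u| + 1) / Num.sqrt (a - u ^+ 2)) * h <=
  Num.sqrt (a - (u + h) ^+ 2) - Num.sqrt (a - u ^+ 2).
Proof.
move=> /andP[h0 h1].
set s := Num.sqrt (a - u ^+ 2); set s' := Num.sqrt _.
have s'0 : 0 <= s' by exact: sqrtr_ge0.
have := sqrtr_ge0 (a - u ^+ 2); rewrite -/s le_eqVlt => /predU1P[<-|s0].
  by rewrite invr0 mulr0 oppr0 mul0r addr0.
have [ss'|ss'] := leP s s'.
  apply: (@le_trans _ _ 0); last by rewrite subr_ge0.
  rewrite mulNr oppr_le0; apply: mulr_ge0 => //.
  by apply: divr_ge0 (ltW s0); rewrite addr_ge0 // mulr_ge0.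
have au : 0 <= a - u ^+ 2 by rewrite ltW // -sqrtr_gt0.
have sE : s ^+ 2 = a - u ^+ 2 by rewrite sqr_sqrtr.
have s'E : a - (u + h) ^+ 2 <= s' ^+ 2.
  have [d0|d0] := leP 0 (a - (u + h) ^+ 2); first by rewrite sqr_sqrtr.
  by rewrite (le_trans (ltW d0)) // sqr_ge0.
rewrite mulNr lerNl opprB mulrAC ler_pdivlMr //.
have un := ler_norm u; have u0 := normr_ge0 u.
(* Factor [s^2 - s'^2] with [s' >= 0]; it is at most [(u + h)^2 - u^2 = 2 u h + h^2], whence the
   constant [2 |u| + 1]. *)
have : (s - s') * s <= s ^+ 2 - s' ^+ 2 by nra.
have : h ^+ 2 <= h by rewrite expr2; nra.
have : u * h <= `|u| * h by rewrite ler_wpM2r.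
nra.
Qed.

Lemma ler_single_sum (R : numDomainType) (n : nat) (F : 'I_n -> R) (i : 'I_n) :
  (forall j, 0 <= F j) -> F i <= \sum_j F j.
Proof. by move=> F0; rewrite (bigD1 i) //= lerDl sumr_ge0. Qed.

(** Start with one line tangent to the disc from below and raise all lines by [h]. The tangent one
    gains a chord of order [sqrt h], while the others lose at most a multiple of [h] in total, so
    the sum cannot stay constant. *)
Lemma orbit_sum_disc_chord_neq (R : realType) (p q : nat) (V : R) :
  odd p -> odd q -> exists (M : nat) (y0 : R), let alpha := p%:R / q%:R in
    [/\ 0 < y0, y0 + alpha * q%:R < M%:R &
        orbit_sum (@disc_chord R) q M alpha y0 <> V].
Proof.
move=> op oq.
have q0 : 0 < q%:R :> R by rewrite ltr0n odd_gt0.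
have p0 : 0 < p%:R :> R by rewrite ltr0n odd_gt0.
pose alpha : R := p%:R / q%:R.
have a0 : 0 < alpha by rewrite divr_gt0.
have aq : alpha * q%:R = p%:R by rewrite divfK // gt_eqF.
pose K := 1 + alpha ^+ 2.
have K0 : 0 < K by rewrite ltr_wpDr // sqr_ge0.
pose A := Num.sqrt (K / 16).
have A0 : 0 < A by rewrite sqrtr_gt0 divr_gt0.
have A2 : A ^+ 2 = K / 16 by rewrite sqr_sqrtr // divr_ge0 // ltW.
(* Intercept of the lower tangent; the shift by [i0] rows makes the height positive, and the term
   [k = 0], [i = i0] sees the tangent line. *)
pose z0 := 1 / 2 - alpha / 2 - A.
pose i0 := (Num.truncn (- z0)).+1.
have i0z : - z0 < i0%:R by exact: truncnS_gt.
pose y0 := z0 + i0%:R.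
have y00 : 0 < y0 by rewrite /y0; lra.
pose M := (i0 + p + 2)%N.
exists M; apply: contrapT => none.
pose f y := orbit_sum (@disc_chord R) q M alpha y.
have fV y : y0 <= y <= y0 + 1 -> f y = V.
  move=> /andP[yy0 yy1]; apply: contrapT => neq; apply: none; exists y; split => //.
    exact: lt_le_trans yy0.
  by rewrite -/alpha aq /M !natrD; rewrite /y0 /z0 in yy1; lra.
pose u (k i : nat) := y0 + alpha * k%:R - i%:R + alpha / 2 - 1 / 2.
pose C k i := (2 * `|u k i| + 1) / Num.sqrt (K / 16 - u k i ^+ 2).
have C0 k i : 0 <= C k i.
  by rewrite divr_ge0 ?sqrtr_ge0 // addr_ge0 // mulr_ge0.
pose Ct := \sum_(k < q) \sum_(i < M) C k i.
have Ct0 : 0 <= Ct by apply: sumr_ge0 => k _; apply: sumr_ge0 => i _; exact: C0.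
(* The last bound gives [(Ct^2 + 1) h <= A / 2], against the inequality [2 A <= (Ct^2 + 1) h]
   reached at the end. *)
pose h := Num.min 1 (Num.min A (A / (2 * (Ct ^+ 2 + 1)))).
have Cp : 0 < 2 * (Ct ^+ 2 + 1) by rewrite mulr_gt0 // ltr_wpDl // sqr_ge0.
have h0 : 0 < h by rewrite !lt_min A0 ltr01 divr_gt0.
have [h1 hA hC] : [/\ h <= 1, h <= A & h * (2 * (Ct ^+ 2 + 1)) <= A].
  by rewrite -ler_pdivlMr // /h !ge_min !lexx !orbT.
clearbody h.
pose D k i := Num.sqrt (K / 16 - (u k i + h) ^+ 2) - Num.sqrt (K / 16 - u k i ^+ 2).
have DC k i : 0 <= D k i + C k i * h.
  rewrite -lerBlDr sub0r -mulNr; apply: sqrt_sub_sqr_lower.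
  by rewrite (ltW h0) h1.
have : \sum_(k < q) \sum_(i < M) D k i = 0.
  apply: (mulfI (lt0r_neq0 (divr_gt0 (ltr0Sn R 1) K0))).
  rewrite mulr0; transitivity (f (y0 + h) - f y0); last first.
    by rewrite !fV ?subrr //; apply/andP; split; lra.
  rewrite /f /orbit_sum mulr_sumr -sumrB; apply: eq_bigr => k _.
  rewrite mulr_sumr -sumrB; apply: eq_bigr => i _.
  rewrite /disc_chord -/K.
  rewrite (_ : y0 + h + _ - _ + _ - _ = u k i + h); last by rewrite /u; ring.
  by rewrite -/(u k i) /D; ring.
move=> D0.
have i0M : (i0 < M)%N by rewrite /M addn2 ltnS (leq_trans (leq_addr p i0)).
have u0 : u 0%N i0 = - A by rewrite /u /y0 /z0; ring.
(* All terms [D + C h] are nonnegative and sum to [Ct h], so the tangent term alone is at most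
   [Ct h]. *)
have : D 0%N i0 + C 0%N i0 * h <= Ct * h.
  have <- : \sum_(k < q) \sum_(i < M) (D k i + C k i * h) = Ct * h.
    transitivity (\sum_(k < q) \sum_(i < M) D k i + Ct * h); last by rewrite D0 add0r.
    rewrite /Ct mulr_suml -big_split; apply: eq_bigr => k _ /=.
    by rewrite mulr_suml -big_split.
  apply: le_trans (ler_single_sum (F := fun k : 'I_q => \sum_(i < M) (D k i + C k i * h))
    (Ordinal (odd_gt0 oq)) _); last by move=> k; apply: sumr_ge0 => i _; exact: DC.
  exact: (ler_single_sum (F := fun i : 'I_M => D 0%N i + C 0%N i * h) (Ordinal i0M)).
have C00 : 0 <= C 0%N i0 * h by rewrite mulr_ge0 // ltW.
rewrite /D u0 sqrrN -A2 subrr sqrtr0 subr0 => hle.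
have sle : Num.sqrt (A ^+ 2 - (- A + h) ^+ 2) <= Ct * h by lra.
have xE : A ^+ 2 - (- A + h) ^+ 2 = h * (2 * A - h) by ring.
have x0 : 0 <= h * (2 * A - h) by rewrite mulr_ge0 ?(ltW h0) //; lra.
have : h * (2 * A - h) <= (Ct * h) ^+ 2.
  rewrite -(sqr_sqrtr x0) -xE lerXn2r // nnegrE ?sqrtr_ge0 //.
  by rewrite mulr_ge0 // ltW.
rewrite exprMn [h ^+ 2]expr2 mulrCA ler_pM2l // => hle'.
have := mulr_ge0 (sqr_ge0 Ct) (ltW h0); lra.
Qed.

Lemma uncountable_disc (R : realType) :
  ~ countable [set alpha : R | [/\ 0 < alpha, irrational alpha &
        exists (c : R * R) (r : R),
          [/\ 0 < r,
              disc c r `<=` @unit_square R &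
              forall x : R * R, @unit_square R x ->
                ~ bounded_remainder_set (disc c r) alpha x]]].
Proof.
move=> cS.
apply: (@uncountable_unbounded_slopes R (@central_disc R) (@disc_chord R)
  (measurable_disc _ _) (@central_disc_sub R) (@chord_length_central_disc R)
  (@cvg_disc_chord R)).
  by move=> p q op oq; exact: orbit_sum_disc_chord_neq.
apply: sub_countable cS; apply: subset_card_le => alpha [a0 ia unb]; split => //.
by exists (1 / 2, 1 / 2), (1 / 4); split => //; exact: central_disc_sub.
Qed.

(** * The unit triangle *)

Lemma Rintegral_affine (R : realType) (a b T : R) : 0 < T ->
  \int[lebesgue_measure]_(t in `[0, T]) (a + b * t) = a * T + b * T ^+ 2 / 2.
Proof.
move=> T0.
pose F (t : R) : R^o := a * t + (b / 2) * t ^+ 2.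
have dF (t : R) : is_derive t 1 F (a + b * t).
  rewrite /F; apply: is_derive_eq.
  by rewrite /GRing.scale /= ; field.
have cF : continuous F.
  by move=> t; apply: differentiable_continuous; apply/derivable1_diffP; case: (dF t).
rewrite /Rintegral (@continuous_FTC2 _ _ F) //.
- by rewrite /F /=; field.
- apply: continuous_subspaceT => t; apply: cvgD; first exact: cvg_cst.
  by apply: cvgM; [exact: cvg_cst|exact: cvg_id].
- split.
  + by move=> t _; case: (dF t).
  + exact: cvg_at_right_filter (cF 0).
  + exact: cvg_at_left_filter (cF T).
- by move=> t _; rewrite derive1E; case: (dF t).
Qed.

Lemma integrable_affine (R : realType) (a b T : R) :
  (@lebesgue_measure R).-integrable `[0, T] (EFin \o (fun t => a + b * t)).
Proof.
apply: continuous_compact_integrable; first exact: segment_compact.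
apply: continuous_subspaceT => t; apply: cvgD; first exact: cvg_cst.
by apply: cvgM; [exact: cvg_cst|exact: cvg_id].
Qed.

Lemma sum_ltn_ord (R : pzSemiRingType) (N k : nat) : (k <= N)%N ->
  \sum_(i < N) (i < k)%N%:R = k%:R :> R.
Proof.
move=> kN; rewrite -[RHS]mulr1n -{2}(card_ord k) -sumr_const.
rewrite (big_ord_widen N (fun _ => 1)) // [RHS]big_mkcond /=.
by apply: eq_bigr => i _; case: (_ < _)%N.
Qed.

Lemma frac_part_bnd (R : realType) (y : R) : 0 <= frac_part y < 1.
Proof.
have /andP[] := floor_itv y; rewrite /frac_part rmorphD /= => h1 h2.
by apply/andP; split; lra.
Qed.

Lemma frac_partDint (R : realType) (y : R) (n : int) :
  frac_part (y + n%:~R) = frac_part y.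
Proof. by rewrite /frac_part floorDrz ?intr_int // intrKfloor rmorphD /=; ring. Qed.

Lemma integrable_frac_part (R : realType) (a b T : R) :
  (@lebesgue_measure R).-integrable `[0, T] (EFin \o (fun t => frac_part (a + b * t))).
Proof.
apply: measurable_bounded_integrable => //.
- exact: lebesgue_measure_itv_bnd_fin.
- apply: measurable_funTS; apply: (measurableT_comp (@measurable_frac_part R)).
  by apply: measurable_funD => //; exact: measurable_funM.
- exists 1; split => [|M M1 t _ /=]; first exact: num_real.
  have /andP[f0 f1] := frac_part_bnd (a + b * t).
  by rewrite ger0_norm // (le_trans (ltW f1) (ltW M1)).
Qed.

(* On [0, T] the floor of a + b t counts the i >= 1 with t >= (i - a) / b. *)
Lemma Rintegral_frac_part_sum (R : realType) (a b T : R) :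
  0 <= a < 1 -> 0 < b -> 0 < T ->
  let N := Num.truncn (a + b * T) in
  \int[lebesgue_measure]_(t in `[0, T]) frac_part (a + b * t) =
  a * T + b * T ^+ 2 / 2 - \sum_(i < N) (T - (i%:R + 1 - a) / b).
Proof.
move=> /andP[a0 a1] b0 T0 N.
have w0 : 0 <= a + b * T by rewrite addr_ge0 // mulr_ge0 // ltW.
have /andP[NT TN] := truncn_itv w0; rewrite -/N in NT TN.
pose c (i : nat) := (i%:R + 1 - a) / b.
have c0 i : 0 <= c i.
  by rewrite divr_ge0 ?(ltW b0) //; have : 0 <= i%:R :> R by []; lra.
have cT (i : 'I_N) : c i <= T.
  rewrite ler_pdivrMr //.
  have : i%:R + 1 <= N%:R :> R by rewrite natr1 ler_nat.
  by lra.
have intc (i : 'I_N) : (@lebesgue_measure R).-integrable `[0, T]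
    (EFin \o \1_(`[c i, T]) : R -> \bar R).
  apply: (@integrable_indic_comp R R `[c i, T]%classic id `[0, T]) => //.
    exact: lebesgue_measure_itv_bnd_fin.
  exact: measurable_indic.
transitivity (\int[lebesgue_measure]_(t in `[0, T])
  ((a + b * t) - \sum_(i < N) \1_(`[c i, T]) t)).
  apply: eq_Rintegral => t; rewrite inE /= in_itv /= => /andP[t0 tT].
  have wt0 : 0 <= a + b * t by rewrite addr_ge0 // mulr_ge0 // ltW.
  have -> : frac_part (a + b * t) = a + b * t - (Num.truncn (a + b * t))%:R.
    by rewrite (@frac_part_truncn _ _ 0) /= subr0.
  congr (_ - _).
  rewrite -(@sum_ltn_ord _ N); last first.
    by apply: le_truncn; rewrite lerD2l ler_pM2l.
  apply: eq_bigr => i _; rewrite truncn_gt_nat indicE.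
  congr (_%:R : R); congr nat_of_bool.
  rewrite mem_setE in_itv /= tT andbT /c ler_pdivrMr // -natr1.
  by apply/idP/idP => h; lra.
rewrite RintegralB //.
- rewrite Rintegral_affine //; congr (_ - _).
  rewrite Rintegral_sum //; apply: eq_bigr => i _.
  rewrite /Rintegral integral_indic // setIidl; last first.
    move=> t /=; rewrite !in_itv /= => /andP[h ->]; rewrite andbT.
    exact: le_trans h.
  rewrite -[LHS]/(fine (@lebesgue_measure R (`[c i, T]%classic : set R))).
  rewrite lebesgue_measure_itv /= lte_fin; case: ltP => // h.
  by apply/eqP; rewrite eq_sym subr_eq0 -/(c i) eq_le h cT.
- exact: integrable_affine.
- rewrite (_ : _ \o _ = fun t => (\sum_(i < N) (\1_(`[c i, T]) t : R)%:E)%E).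
    by apply: integrable_sum => // i _; exact: intc.
  by apply/funext => t /=; rewrite sumEFin.
Qed.

(** The centred sawtooth [y - 1 / 2] has the periodic antiderivative [(y^2 - y) / 2]; the error is
    its increment from [a] to the final phase [phi], divided by [b]. *)
Lemma Rintegral_frac_part_bounded (R : realType) (a b T : R) : 0 < b -> 0 < T ->
  `|\int[lebesgue_measure]_(t in `[0, T]) frac_part (a + b * t) - T / 2| <= (2 * b)^-1.
Proof.
move=> b0 T0.
have [a0 a1] := andP (frac_part_bnd a).
have -> : \int[lebesgue_measure]_(t in `[0, T]) frac_part (a + b * t) =
          \int[lebesgue_measure]_(t in `[0, T]) frac_part (frac_part a + b * t).
  apply: eq_Rintegral => t _; rewrite -[RHS](frac_partDint _ (Num.floor a)).
  by congr frac_part; rewrite /frac_part; ring.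
move: (frac_part a) a0 a1 => {}a a0 a1.
rewrite Rintegral_frac_part_sum ?a0 //=.
set N := Num.truncn _.
have w0 : 0 <= a + b * T by rewrite addr_ge0 // mulr_ge0 // ltW.
have /andP[NT TN] := truncn_itv w0; rewrite -/N -(natr1 N) in NT TN.
have sumE n : \sum_(i < n) (T - (i%:R + 1 - a) / b) =
    n%:R * T - (n%:R * (n%:R + 1) / 2 - n%:R * a) / b.
  elim: n => [|n IH]; first by rewrite big_ord0; field; lra.
  by rewrite big_ord_recr /= IH -natr1; field; lra.
rewrite sumE.
pose phi := a + b * T - N%:R.
have TE : T = (N%:R + phi - a) / b by rewrite /phi; field; lra.
have -> : a * T + b * T ^+ 2 / 2 - (N%:R * T - (N%:R * (N%:R + 1) / 2 - N%:R * a) / b) - T / 2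
  = (phi ^+ 2 - phi - a ^+ 2 + a) * (2 * b)^-1.
  by rewrite TE; field; lra.
rewrite normrM [X in _ * X]gtr0_norm ?invr_gt0 ?mulr_gt0 //.
rewrite ler_piMl ?invr_ge0 ?mulr_ge0 ?(ltW b0) // ler_norml.
have p0 : 0 <= phi by rewrite /phi; lra.
have p1 : phi < 1 by rewrite /phi; lra.
have := sqr_ge0 phi; have := sqr_ge0 a.
by move=> *; apply/andP; split; nra.
Qed.

(** The intersection removes just the vertices [(1, 0)] and [(0, 1)]. *)
Definition unit_triangle (R : realType) : set (R * R) :=
  triangle (0, 0) (1, 0) (0, 1) `&` @unit_square R.

Lemma unit_triangleP (R : realType) (u v : R) :
  unit_triangle (u, v) <-> [/\ 0 <= u < 1, 0 <= v < 1 & u + v <= 1].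
Proof.
rewrite /unit_triangle /unit_square; split.
  move=> [/(right_triangleP _ ltr01) [/= _ _ h3] [] /=].
  by rewrite !in_itv.
move=> [h1 h2 h3]; split; last by split; rewrite /= in_itv.
apply/(right_triangleP _ ltr01); split => //=.
  by case/andP: h1.
by case/andP: h2.
Qed.

Lemma measurable_unit_triangle (R : realType) : measurable (@unit_triangle R).
Proof.
apply: measurableI; last exact: measurable_unit_square.
by apply: measurable_triangle; rewrite /collinear /= => h; lra.
Qed.

Lemma xsection_unit_triangle (R : realType) (x : R) :
  (@lebesgue_measure R) (xsection (@unit_triangle R) x) =
  ((fun y : R => (1 - y)%:E) \_ `[0, 1[) x :> \bar R.
Proof.
rewrite patchE; case: ifPn => [|xN]; last first.
  rewrite (_ : xsection _ _ = set0) ?measure0 //.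
  apply/seteqP; split => // y; rewrite /xsection /= inE => /unit_triangleP [h _ _].
  by move: xN; rewrite mem_setE in_itv /= h.
rewrite mem_setE in_itv /= => /andP[x0 x1].
(* At [x = 0] the section is half-open, because the vertex [(0, 1)] is cut off. *)
have [xz|xz] := eqVneq x 0.
  rewrite (_ : xsection _ _ = `[0, 1[%classic).
    by rewrite lebesgue_measure_itv /= lte_fin ltr01 xz subr0 oppr0 adde0.
  apply/seteqP; split => y; rewrite /xsection /= inE in_itv /=.
    by case/unit_triangleP.
  move=> /andP[y0 y1]; apply/unit_triangleP; rewrite xz lexx ltr01 y0 y1; split => //.
  by rewrite add0r ltW.
have {}x0 : 0 < x by rewrite lt_neqAle eq_sym xz.
rewrite (_ : xsection _ _ = `[0, 1 - x]%classic).
  by rewrite lebesgue_measure_itv /= lte_fin subr_gt0 x1 oppr0 adde0.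
apply/seteqP; split => y; rewrite /xsection /= inE in_itv /=.
  by case/unit_triangleP => _ /andP[y0 y1] xy; apply/andP; split; lra.
move=> /andP[y0 y1]; apply/unit_triangleP; split; [|apply/andP; split|]; lra.
Qed.

Lemma area_unit_triangle (R : realType) : area (@unit_triangle R) = 1 / 2.
Proof.
have i01 := @integrable_affine R 1 (-1) 1.
rewrite /area /product_measure1.
under eq_integral do rewrite /= xsection_unit_triangle.
rewrite -integral_mkcond.
rewrite -[LHS]/(\int[lebesgue_measure]_(y in `[0, 1[) (1 - y)).
transitivity (\int[lebesgue_measure]_(y in `[0, 1]) (1 + (-1) * y : R)).
  rewrite -Rintegral_itv_bndo_bndc.
    by apply: eq_Rintegral => y _; rewrite mulN1r.
  by apply: integrableS i01 => // y /=; rewrite !in_itv /= => /andP[-> /ltW ->].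
by rewrite Rintegral_affine //; field.
Qed.

(** The subtracted boolean is the carry; its complement is, off the hypotenuse, the indicator of the
    unit triangle. *)
Lemma frac_partD (R : realType) (u v : R) :
  frac_part (u + v) = frac_part u + frac_part v - (1 <= frac_part u + frac_part v)%R%:R.
Proof.
have /andP[u0 u1] := frac_part_bnd u; have /andP[v0 v1] := frac_part_bnd v.
set b := (1 <= _).
have -> : u + v = frac_part u + frac_part v + (Num.floor u + Num.floor v)%:~R.
  by rewrite rmorphD /frac_part /=; ring.
rewrite frac_partDint {1}/frac_part; congr (_ - _).
have -> : Num.floor (frac_part u + frac_part v) = (b : nat)%:Z.
  apply: floor_def; rewrite -pmulrn rmorphD /= -pmulrn /b.
  by case: (leP 1 (frac_part u + frac_part v)) => h /=; apply/andP; split; lra.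
by rewrite -pmulrn.
Qed.

(* Off the null set of times at which the orbit meets the hypotenuse (mod 1),
   the indicator of the triangle is 1 - {u} - {v} + {u + v}. *)
Lemma Rintegral_unit_triangle (R : realType) (alpha : R) (x : R * R) (T : R) :
  0 < alpha -> 0 < T ->
  \int[lebesgue_measure]_(t in `[0, T]) \1_(@unit_triangle R) (rotation alpha x t) =
  T - \int[lebesgue_measure]_(t in `[0, T]) frac_part (x.1 + 1 * t)
    - \int[lebesgue_measure]_(t in `[0, T]) frac_part (x.2 + alpha * t)
    + \int[lebesgue_measure]_(t in `[0, T]) frac_part (x.1 + x.2 + (1 + alpha) * t).
Proof.
move=> a0 T0.
have a10 : 0 < 1 + alpha by lra.
have i1 := @integrable_frac_part R x.1 1 T.
have i2 := @integrable_frac_part R x.2 alpha T.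
have i3 := @integrable_frac_part R (x.1 + x.2) (1 + alpha) T.
have i0 : (@lebesgue_measure R).-integrable `[0, T] (EFin \o (fun _ => 1 : R)).
  have := @integrable_affine R 1 0 T.
  by rewrite (_ : (fun _ => _) = fun _ => 1) //; apply/funext => t; rewrite mul0r addr0.
have iS := @integrable_indic_rotation R _ alpha x 0 T true false
  (@measurable_unit_triangle R).
pose f1 t := frac_part (x.1 + 1 * t).
pose f2 t := frac_part (x.2 + alpha * t).
pose f3 t := frac_part (x.1 + x.2 + (1 + alpha) * t).
have i01 : (@lebesgue_measure R).-integrable `[0, T] (EFin \o (fun t => 1 - f1 t)).
  exact: (integrableB _ i0 i1).
have i012 : (@lebesgue_measure R).-integrable `[0, T] (EFin \o (fun t => 1 - f1 t - f2 t)).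
  exact: (integrableB _ i01 i2).
have i0123 : (@lebesgue_measure R).-integrable `[0, T]
    (EFin \o (fun t => 1 - f1 t - f2 t + f3 t)).
  exact: (integrableD _ i012 i3).
transitivity (\int[lebesgue_measure]_(t in `[0, T])
  (1 - frac_part (x.1 + 1 * t) - frac_part (x.2 + alpha * t)
    + frac_part (x.1 + x.2 + (1 + alpha) * t))).
  congr fine; apply: ae_eq_integral => //.
  - exact: (measurable_int _ iS).
  - exact: (measurable_int _ i0123).
  (* Times at which the unreduced coordinates add up to an integer: a countable set containing all
     crossings of the hypotenuse. *)
  pose Z := [set t : R | exists n : int, t = (n%:~R - (x.1 + x.2)) / (1 + alpha)].
  have cZ : countable Z.
    apply: (@sub_countable _ _ _ [set: int]); last exact: countableP.
    apply: card_le_trans (card_image_le (fun n : int => (n%:~R - (x.1 + x.2)) / (1 + alpha)) _).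
    by apply: subset_card_le => t [n ->]; exists n.
  have mZ : measurable Z by apply: countable_measurable.
  exists Z; split; [exact: mZ|exact: countable_lebesgue_measure0|].
  move=> t /= tZ; apply: contrapT => nZ; apply: tZ => _ /=; congr EFin.
  have ne1 : frac_part (x.1 + t) + frac_part (x.2 + alpha * t) <> 1.
    move=> e1; apply: nZ.
    exists (1 + Num.floor (x.1 + t) + Num.floor (x.2 + alpha * t)).
    move: e1; rewrite /frac_part !rmorphD /= => e1.
    by apply: (mulIf (lt0r_neq0 a10)); rewrite divfK ?lt0r_neq0 //; lra.
  rewrite mul1r (_ : x.1 + x.2 + (1 + alpha) * t = (x.1 + t) + (x.2 + alpha * t)); last by ring.
  rewrite (frac_partD (x.1 + t)) /rotation indicE.
  have bu := frac_part_bnd (x.1 + t); have bv := frac_part_bnd (x.2 + alpha * t).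
  case: (leP 1 (frac_part (x.1 + t) + frac_part (x.2 + alpha * t))) => h.
    rewrite (_ : _ \in _ = false); first by rewrite /=; ring.
    apply/negbTE; rewrite notin_setE => /unit_triangleP [_ _ h'].
    by apply: ne1; lra.
  rewrite (_ : _ \in _ = true); first by rewrite /=; ring.
  by apply/mem_set/unit_triangleP; split => //; exact: ltW.
have I0 : \int[lebesgue_measure]_(t in `[0, T]) (1 : R) = T.
  transitivity (\int[lebesgue_measure]_(t in `[0, T]) (1 + 0 * t : R)).
    by apply: eq_Rintegral => t _; rewrite mul0r addr0.
  by rewrite Rintegral_affine //; ring.
by rewrite RintegralD // RintegralB // RintegralB // I0.
Qed.

(** The main terms [T - T / 2 - T / 2 + T / 2] cancel against [T] times the area; what remains is
    three sawtooth errors, of frequencies [1], [alpha] and [1 + alpha]. *)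
Lemma bounded_remainder_unit_triangle (R : realType) (alpha : R) (x : R * R) :
  0 < alpha -> bounded_remainder_set (@unit_triangle R) alpha x.
Proof.
move=> a0; exists ((2 * 1)^-1 + (2 * alpha)^-1 + (2 * (1 + alpha))^-1) => T T0.
have a10 : 0 < 1 + alpha by lra.
rewrite /discrepancy area_unit_triangle Rintegral_unit_triangle //.
have := Rintegral_frac_part_bounded x.1 ltr01 T0.
have := Rintegral_frac_part_bounded x.2 a0 T0.
have := Rintegral_frac_part_bounded (x.1 + x.2) a10 T0.
move: (\int[_]_(_ in _) _) (\int[_]_(_ in _) _) (\int[_]_(_ in _) _) => I3 I2 I1.
rewrite !ler_norml => /andP[h1 h2] /andP[h3 h4] /andP[h5 h6].
by apply/andP; split; lra.
Qed.

Theorem theorem3 (R : realType) :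
  [/\ ~ countable [set alpha : R | [/\ 0 < alpha, irrational alpha &
        exists a b c : R * R,
          [/\ ~ collinear a b c,
              triangle a b c `<=` @unit_square R,
              [/\ ~ has_slope a b alpha, ~ has_slope b c alpha &
                  ~ has_slope c a alpha] &
              forall x : R * R, @unit_square R x ->
                ~ bounded_remainder_set (triangle a b c) alpha x]]],
      ~ countable [set alpha : R | [/\ 0 < alpha, irrational alpha &
        exists (c : R * R) (r : R),
          [/\ 0 < r,
              disc c r `<=` @unit_square R &
              forall x : R * R, @unit_square R x ->
                ~ bounded_remainder_set (disc c r) alpha x]]] &
      forall (alpha : R) (x : R * R),
        0 < alpha -> irrational alpha -> @unit_square R x ->
        bounded_remainder_set
          (triangle (0, 0) (1, 0) (0, 1) `&` @unit_square R) alpha x].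
Proof.
split; [exact: uncountable_triangle|exact: uncountable_disc|].
by move=> alpha x a0 _ _; exact: bounded_remainder_unit_triangle.
Qed.
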